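(* Let $(\mathcal B,\mathbb E,\mathfrak s)$ be an extriangulated category with enough projectives, with subcategory of projectives $\mathcal P$, and let $(\mathcal U,\mathcal V)$ be a cotorsion pair on $\mathcal B$ with coheart $\mathcal C$ and kernel $\mathcal K$. If $(\mathcal C,\mathcal K)$ is a cotorsion pair, then the heart $\underline{\mathcal H}$ of $(\mathcal U,\mathcal V)$ satisfies $\underline{\mathcal H}\simeq\mathrm{mod}(\mathcal C/\mathcal P)$ (equivalence of categories).
   Context: Extriangulated category $(\mathcal B,\mathbb E,\mathfrak s)$: (ET1) $\mathcal B$ is an additive category and $\mathbb E\colon\mathcal B^{\mathrm{op}}\times\mathcal B\to \mathrm{Ab}$ is an additive bifunctor; for $\delta\in\mathbb E(C,A)$, $a\colon A\to A'$, $c\colon C'\to C$ write $a_*\delta=\mathbb E(C,a)(\delta)$ and $c^*\delta=\mathbb E(c,A)(\delta)$. Sequences $A\to B\to C$ and $A\to B'\to C$ are equivalent if there is an isomorphism $B\cong B'$ compatible with the identities of $A$ and $C$. $\mathfrak s$ assigns to each $\delta\in\mathbb E(C,A)$ an equivalence class $\mathfrak s(\delta)=[A\xrightarrow{x}B\xrightarrow{y}C]$; we say $A\xrightarrow{x}B\xrightarrow{y}C$ realizes $\delta$. (ET2) $\mathfrak s$ is an additive realization: if $A\xrightarrow{x}B\xrightarrow{y}C$ realizes $\delta$, $A'\xrightarrow{x'}B'\xrightarrow{y'}C'$ realizes $\delta'$ and $a\colon A\to A'$, $c\colon C\to C'$ satisfy $a_*\delta=c^*\delta'$, then there is $b\colon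 B\to B'$ with $bx=x'a$, $y'b=cy$; $0\in\mathbb E(C,A)$ is realized by the split sequence $A\to A\oplus C\to C$; and $\mathfrak s(\delta\oplus\delta')=\mathfrak s(\delta)\oplus\mathfrak s(\delta')$. (ET3) If $A\xrightarrow{x}B\xrightarrow{y}C$ realizes $\delta\in\mathbb E(C,A)$, $A'\xrightarrow{x'}B'\xrightarrow{y'}C'$ realizes $\delta'\in\mathbb E(C',A')$ and $a\colon A\to A'$, $b\colon B\to B'$ satisfy $bx=x'a$, then there is $c\colon C\to C'$ with $cy=y'b$ and $a_*\delta=c^*\delta'$; and (ET3)$^{\mathrm{op}}$, its dual. (ET4) If $\delta\in\mathbb E(D,A)$ and $\delta'\in\mathbb E(F,B)$ are realized by $A\xrightarrow{f}B\xrightarrow{f'}D$ and $B\xrightarrow{g}C\xrightarrow{g'}F$, there are an object $E$, morphisms $d\colon D\to E$, $e\colon E\to F$, $h'\colon C\to E$ with $h'g=df'$, $eh'=g'$, and $\delta''\in\mathbb E(E,A)$ realized by $A\xrightarrow{gf}C\xrightarrow{h'}E$, such that $D\xrightarrow{d}E\xrightarrow{e}F$ realizes $f'_*\delta'$, $d^*\delta''=\delta$ and $f_*\delta''=e^*\delta'$; and (ET4)$^{\mathrm{op}}$, its dual. A conflation $A\rightarrowtail B\twoheadrightarrow C$ is a sequence realizing some $\delta\in\mathbb E(C,A)$; its second morphism is called a deflation. An object $P$ is projective if $\mathbb E(P,\mathcal B)=0$; $\mathcal P$ is the full subcategory of projectives; $\mathcal B$ has enough projectives if every object $B$ admits a deflation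 $P\to B$ with $P\in\mathcal P$. For full subcategories $\mathcal X,\mathcal Y\subseteq\mathcal B$: $\mathrm{Cone}(\mathcal X,\mathcal Y)$ is the full subcategory of objects $B$ admitting a conflation $X\rightarrowtail Y\twoheadrightarrow B$, and $\mathrm{CoCone}(\mathcal X,\mathcal Y)$ that of objects $B$ admitting a conflation $B\rightarrowtail X\twoheadrightarrow Y$, and $\mathcal X\ast\mathcal Y$ that of objects $B$ admitting a conflation $X\rightarrowtail B\twoheadrightarrow Y$, with $X\in\mathcal X$, $Y\in\mathcal Y$. A cotorsion pair $(\mathcal U,\mathcal V)$ on $\mathcal B$ is a pair of full additive subcategories closed under direct summands and isomorphisms with $\mathbb E(\mathcal U,\mathcal V)=0$ and such that every $B\in\mathcal B$ admits conflations $V_B\rightarrowtail U_B\twoheadrightarrow B$ and $B\rightarrowtail V^B\twoheadrightarrow U^B$ with $U_B,U^B\in\mathcal U$, $V_B,V^B\in\mathcal V$. Put $\mathcal W=\mathcal U\cap\mathcal V$, $\mathcal B^+=\mathrm{Cone}(\mathcal V,\mathcal W)$, $\mathcal B^-=\mathrm{CoCone}(\mathcal W,\mathcal U)$, $\mathcal H=\mathcal B^+\cap\mathcal B^-$. The heart is $\underline{\mathcal H}=\mathcal H/\mathcal W$ (ideal quotient by morphisms factoring through objects of $\mathcal W$). The kernel of $(\mathcal U,\mathcal V)$ is $\mathcal K=\mathrm{add}(\mathcal U\ast\mathcal V)$ ($\mathrm{add}$ = closure under direct summands in $\mathcal B$). The coheart is $\mathcal C={}^{\perp_1}\mathcal K=\mathcal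 U\cap{}^{\perp_1}\mathcal U$, where ${}^{\perp_1}\mathcal X=\{X\in\mathcal B\mid\mathbb E(X,\mathcal X)=0\}$. One has $\mathcal P\subseteq\mathcal C$, and $\mathcal C/\mathcal P$ is the ideal quotient. For an additive category $\mathcal A$, $\mathrm{mod}(\mathcal A)$ denotes the category of coherent functors over $\mathcal A$: additive functors $F\colon\mathcal A^{\mathrm{op}}\to\mathrm{Ab}$ admitting an exact sequence $\mathcal A(-,A_1)\to\mathcal A(-,A_0)\to F\to0$ with $A_0,A_1\in\mathcal A$. *)

(* Defs.v *)
From HB Require Import structures.
From mathcomp Require Import all_boot all_algebra boolp.

Set Implicit Arguments.
Unset Strict Implicit.
Unset Printing Implicit Defensive.

Import GRing.Theory.
Local Open Scope ring_scope.

Declare Scope cat_scope.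
Delimit Scope cat_scope with cat.

#[local] Obligation Tactic := idtac.

Record category := Category {
  cobj :> Type;
  mor : cobj -> cobj -> Type;
  cid : forall X, mor X X;
  ccomp : forall X Y Z, mor Y Z -> mor X Y -> mor X Z;
  ccompA : forall X Y Z T (h : mor Z T) (g : mor Y Z) (f : mor X Y),
    ccomp h (ccomp g f) = ccomp (ccomp h g) f;
  ccomp1m : forall X Y (f : mor X Y), ccomp (cid Y) f = f;
  ccompm1 : forall X Y (f : mor X Y), ccomp f (cid X) = f
}.

Record functor (C D : category) := Functor {
  fobj :> C -> D;
  fmap : forall X Y, mor X Y -> mor (fobj X) (fobj Y);
  fmap1 : forall X, fmap (cid X) = cid (fobj X);
  fmap_comp : forall X Y Z (g : mor Y Z) (f : mor X Y),
    fmap (ccomp g f) = ccomp (fmap g) (fmap f)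
}.

Definition functor_id (C : category) : functor C C :=
  @Functor C C (fun X => X) (fun X Y f => f)
    (fun=> erefl) (fun _ _ _ _ _ => erefl).

Program Definition functor_comp (C D E : category)
    (G : functor D E) (F : functor C D) : functor C E :=
  @Functor C E (fun X => G (F X)) (fun X Y f => fmap G (fmap F f)) _ _.
Next Obligation. by move=> C D E G F X /=; rewrite !fmap1. Qed.
Next Obligation. by move=> C D E G F X Y Z g f /=; rewrite !fmap_comp. Qed.

Definition is_isomorphism (C : category) (X Y : C) (f : mor X Y) : Prop :=
  exists g : mor Y X, ccomp g f = cid X /\ ccomp f g = cid Y.

Definition naturally_isomorphic (C D : category) (F G : functor C D) : Prop :=
  exists eta : forall X, mor (F X) (G X),
    (forall X, is_isomorphism (eta X)) /\
    (forall X Y (f : mor X Y),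
       ccomp (eta Y) (fmap F f) = ccomp (fmap G f) (eta X)).

Definition equivalent (C D : category) : Prop :=
  exists (F : functor C D) (G : functor D C),
    naturally_isomorphic (functor_comp G F) (functor_id C) /\
    naturally_isomorphic (functor_comp F G) (functor_id D).

(* Preadditive categories. *)
Record precat := Precat {
  obj :> Type;
  hom : obj -> obj -> zmodType;
  idm : forall A, hom A A;
  comp : forall A B C, hom B C -> hom A B -> hom A C;
  compA : forall A B C D (h : hom C D) (g : hom B C) (f : hom A B),
    comp h (comp g f) = comp (comp h g) f;
  comp1m : forall A B (f : hom A B), comp (idm B) f = f;
  compm1 : forall A B (f : hom A B), comp f (idm A) = f;
  compDl : forall A B C (g g' : hom B C) (f : hom A B),
    comp (g + g') f = comp g f + comp g' f;
  compDr : forall A B C (g : hom B C) (f f' : hom A B),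
    comp g (f + f') = comp g f + comp g f'
}.

Notation "g \oc f" := (comp g f)
  (at level 40, left associativity) : cat_scope.
Local Open Scope cat_scope.

Definition category_of (B : precat) : category :=
  Category (@compA B) (@comp1m B) (@compm1 B).

Definition fullsub (B : precat) (X : B -> Prop) : precat :=
  @Precat {A : B | X A} (fun A C => hom (sval A) (sval C))
    (fun A => idm (sval A)) (fun _ _ _ g f => g \oc f)
    (fun _ _ _ _ h g f => compA h g f)
    (fun _ _ f => comp1m f) (fun _ _ f => compm1 f)
    (fun _ _ _ g g' f => compDl g g' f)
    (fun _ _ _ g f f' => compDr g f f').

Section Preadditive.
Variable B : precat.

Lemma comp0m (A C D : B) (f : hom A C) : (0 : hom C D) \oc f = 0.
Proof. by apply: (addrI (0 \oc f)); rewrite -compDl !addr0. Qed.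

Lemma compm0 (A C D : B) (g : hom C D) : g \oc (0 : hom A C) = 0.
Proof. by apply: (addrI (g \oc 0)); rewrite -compDr !addr0. Qed.

Lemma compNm (A C D : B) (g : hom C D) (f : hom A C) :
  (- g) \oc f = - (g \oc f).
Proof. by apply: (addrI (g \oc f)); rewrite -compDl !subrr comp0m. Qed.

Lemma compmN (A C D : B) (g : hom C D) (f : hom A C) :
  g \oc (- f) = - (g \oc f).
Proof. by apply: (addrI (g \oc f)); rewrite -compDr !subrr compm0. Qed.

Definition is_iso (A C : B) (f : hom A C) : Prop :=
  exists g : hom C A, g \oc f = idm A /\ f \oc g = idm C.

Definition isomorphic (A C : B) : Prop := exists f : hom A C, is_iso f.

Definition is_zero (Z : B) : Prop :=
  forall A, (forall f : hom Z A, f = 0) /\ (forall f : hom A Z, f = 0).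

Record biproduct (A C S : B) := Biproduct {
  in1 : hom A S;
  in2 : hom C S;
  pr1 : hom S A;
  pr2 : hom S C;
  pr1in1 : pr1 \oc in1 = idm A;
  pr2in2 : pr2 \oc in2 = idm C;
  pr1in2 : pr1 \oc in2 = 0;
  pr2in1 : pr2 \oc in1 = 0;
  biprod_id : in1 \oc pr1 + in2 \oc pr2 = idm S
}.

Definition summand (A S : B) : Prop := exists C, inhabited (biproduct A C S).

Definition mor_sum (A A' AA' C C' CC' : B)
    (S : biproduct A A' AA') (T : biproduct C C' CC')
    (f : hom A C) (f' : hom A' C') : hom AA' CC' :=
  in1 T \oc f \oc pr1 S + in2 T \oc f' \oc pr2 S.

Definition seq_equiv (A C M M' : B) (x : hom A M) (y : hom M C)
    (x' : hom A M') (y' : hom M' C) : Prop :=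
  exists b : hom M M', [/\ is_iso b, b \oc x = x' & y' \oc b = y].

Definition factors (W : B -> Prop) (A C : B) (f : hom A C) : Prop :=
  exists (D : B) (g : hom D C) (h : hom A D), W D /\ f = g \oc h.

(* All zero objects and all biproducts are required to lie in X: the full
   additive subcategories considered here are closed under isomorphisms. *)
Record additive_sub (X : B -> Prop) : Prop := AdditiveSub {
  addsub_zero : forall Z, is_zero Z -> X Z;
  addsub_sum : forall A C S, biproduct A C S -> X A -> X C -> X S
}.

Definition iso_closed (X : B -> Prop) : Prop :=
  forall A C, isomorphic A C -> X A -> X C.

Definition summand_closed (X : B -> Prop) : Prop :=
  forall A S, summand A S -> X S -> X A.

Definition add_closure (X : B -> Prop) (A : B) : Prop :=
  exists S, X S /\ summand A S.

End Preadditive.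

Record addcat := Addcat {
  addcat_precat :> precat;
  has_zero : exists Z : addcat_precat, is_zero Z;
  has_biproducts : forall A C : addcat_precat,
    exists S, inhabited (biproduct A C S)
}.

Section IdealQuotient.
Variables (B : addcat) (W : B -> Prop) (addW : additive_sub W).

(* The unused proof argument lets the zmodClosed instance below be inferred. *)
Definition factor_pred (_ : additive_sub W) (A C : B) : pred (hom A C) :=
  fun f => `[< factors W f >].
Arguments factor_pred : clear implicits.

Lemma factor_zmod_closed (A C : B) : zmod_closed (factor_pred addW A C).
Proof.
split=> [|f f' /asboolP[D [g [h [WD ->]]]] /asboolP[D' [g' [h' [WD' ->]]]]];
  apply/asboolP.
  have [Z Z0] := has_zero B; exists Z, 0, 0; rewrite comp0m; split=> //.
  exact: addsub_zero addW _ Z0.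
have [S [b]] := has_biproducts D D'.
exists S, (g \oc pr1 b - g' \oc pr2 b), (in1 b \oc h + in2 b \oc h').
split; first exact: addsub_sum addW _ _ _ b WD WD'.
rewrite compDl !compDr !compNm -!compA (compA (pr1 b) (in1 b)).
rewrite (compA (pr1 b) (in2 b)) (compA (pr2 b) (in1 b)).
rewrite (compA (pr2 b) (in2 b)).
by rewrite pr1in1 pr1in2 pr2in1 pr2in2 !comp1m !comp0m !compm0 addr0 oppr0 add0r.
Qed.

HB.instance Definition _ (A C : B) :=
  GRing.isZmodClosed.Build (hom A C) (factor_pred addW A C)
    (factor_zmod_closed A C).

Definition factor_closed (A C : B) : zmodClosed (hom A C) :=
  GRing.ZmodClosed.clone (hom A C) (factor_pred addW A C) _.

Definition qhom (A C : B) : zmodType := Quotient.quot (factor_closed A C).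

Definition qpi (A C : B) (f : hom A C) : qhom A C :=
  \pi_(Quotient.quot (factor_closed A C))%qT f.

Definition qrepr (A C : B) (f : qhom A C) : hom A C :=
  @repr (hom A C) (Quotient.quot (factor_closed A C)) f.

Lemma qreprK (A C : B) (f : qhom A C) : qpi (qrepr f) = f.
Proof. exact: reprK. Qed.

Lemma qpi_eq (A C : B) (f f' : hom A C) :
  qpi f = qpi f' <-> factors W (f - f').
Proof.
split=> [/eqP|] h.
  by apply/asboolP; move: h; rewrite /qpi -Quotient.idealrBE.
by apply/eqP; rewrite /qpi -Quotient.idealrBE; apply/asboolP.
Qed.

Lemma qpiD (A C : B) (f f' : hom A C) : qpi (f + f') = qpi f + qpi f'.
Proof. exact: Quotient.pi_add. Qed.

Definition qcomp (A C D : B) (g : qhom C D) (f : qhom A C) : qhom A D :=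
  qpi (qrepr g \oc qrepr f).

Lemma qcompE (A C D : B) (g : hom C D) (f : hom A C) :
  qcomp (qpi g) (qpi f) = qpi (g \oc f).
Proof.
have /qpi_eq[D1 [g1 [h1 [W1 e1]]]] := qreprK (qpi g).
have /qpi_eq[D2 [g2 [h2 [W2 e2]]]] := qreprK (qpi f).
transitivity (qpi (qrepr (qpi g) \oc f)); apply/qpi_eq.
  exists D2, (qrepr (qpi g) \oc g2), h2; split=> //.
  by rewrite -compA -e2 compDr compmN.
by exists D1, g1, (h1 \oc f); rewrite compA -e1 compDl compNm.
Qed.

Program Definition idealquot : precat :=
  @Precat B qhom (fun A => qpi (idm A)) qcomp _ _ _ _ _.
Next Obligation.
by move=> A C D E h g f; rewrite -(qreprK f) -(qreprK g) -(qreprK h)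
  !qcompE compA.
Qed.
Next Obligation. by move=> A C f; rewrite -(qreprK f) qcompE comp1m. Qed.
Next Obligation. by move=> A C f; rewrite -(qreprK f) qcompE compm1. Qed.
Next Obligation.
by move=> A C D g g' f; rewrite -(qreprK f) -(qreprK g) -(qreprK g')
  -qpiD !qcompE -qpiD compDl.
Qed.
Next Obligation.
by move=> A C D g f f'; rewrite -(qreprK f) -(qreprK f') -(qreprK g)
  -qpiD !qcompE -qpiD compDr.
Qed.

End IdealQuotient.

Section Coherent.
Variable A : precat.

(* Additive functors A^op -> Ab. *)
Record addfun := Addfun {
  afobj :> A -> zmodType;
  afmap : forall X Y, hom X Y -> afobj Y -> afobj X;
  afmapD : forall X Y (f : hom X Y), {morph afmap f : s t / s + t};
  afmap_add : forall X Y (f f' : hom X Y) s,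
    afmap (f + f') s = afmap f s + afmap f' s;
  afmap1 : forall X s, afmap (idm X) s = s;
  afmap_comp : forall X Y Z (g : hom Y Z) (f : hom X Y) s,
    afmap (g \oc f) s = afmap f (afmap g s)
}.

Record nattrans (F G : addfun) := Nattrans {
  ntmap :> forall X, F X -> G X;
  ntmapD : forall X, {morph @ntmap X : s t / s + t};
  ntnat : forall X Y (f : hom X Y) s,
    ntmap (afmap f s) = afmap f (ntmap s)
}.

Lemma nattrans_eq (F G : addfun) (a b : nattrans F G) :
  (forall X s, a X s = b X s) -> a = b.
Proof.
case: a b => [a aD an] [b bD bn] /= eab.
have {eab} eab : a = b by apply: functional_extensionality_dep => X; apply: funext.
by case: b / eab bD bn => bD bn; congr Nattrans; apply: Prop_irrelevance.
Qed.

Definition nt_id (F : addfun) : nattrans F F :=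
  @Nattrans F F (fun _ s => s) (fun _ _ _ => erefl) (fun _ _ _ _ => erefl).

Program Definition nt_comp (F G H : addfun)
    (b : nattrans G H) (a : nattrans F G) : nattrans F H :=
  @Nattrans F H (fun X s => b X (a X s)) _ _.
Next Obligation. by move=> F G H b a X s t /=; rewrite !ntmapD. Qed.
Next Obligation. by move=> F G H b a X Y f s /=; rewrite !ntnat. Qed.

Definition representable (C : A) : addfun :=
  @Addfun (fun X => hom X C) (fun _ _ f s => s \oc f)
    (fun _ _ f s t => compDl s t f) (fun _ _ f f' s => compDr s f f')
    (fun _ s => compm1 s) (fun _ _ _ g f s => compA s g f).

Definition coherent (F : addfun) : Prop :=
  exists (A1 A0 : A) (a : nattrans (representable A1) (representable A0))
         (b : nattrans (representable A0) F),
    (forall X (s : hom X A0), b X s = 0 <-> exists r, a X r = s) /\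
    (forall X (t : F X), exists s, b X s = t).

(* All natural transformations; no smallness condition on A is needed because
   the morphisms of a [category] form a plain type. *)
Program Definition mod_cat : category :=
  @Category {F : addfun | coherent F}
    (fun F G => nattrans (sval F) (sval G))
    (fun F => nt_id (sval F)) (fun _ _ _ b a => nt_comp b a) _ _ _.
Next Obligation. by move=> *; apply: nattrans_eq. Qed.
Next Obligation. by move=> *; apply: nattrans_eq. Qed.
Next Obligation. by move=> *; apply: nattrans_eq. Qed.

End Coherent.

(* An additive bifunctor B^op x B -> Ab: [ext C A] is the group E(C, A),
   [push a d] is a_* d and [pull c d] is c^* d. *)
Record bifunctor (B : precat) := Bifunctor {
  ext :> B -> B -> zmodType;
  push : forall C A A', hom A A' -> ext C A -> ext C A';
  pull : forall C C' A, hom C' C -> ext C A -> ext C' A;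
  pushD : forall C A A' (a : hom A A'), {morph @push C A A' a : d e / d + e};
  push_add : forall C A A' (a a' : hom A A') (d : ext C A),
    push (a + a') d = push a d + push a' d;
  push1 : forall C A (d : ext C A), push (idm A) d = d;
  push_comp : forall C A A' A'' (a' : hom A' A'') (a : hom A A')
    (d : ext C A), push (a' \oc a) d = push a' (push a d);
  pullD : forall C C' A (c : hom C' C), {morph @pull C C' A c : d e / d + e};
  pull_add : forall C C' A (c c' : hom C' C) (d : ext C A),
    pull (c + c') d = pull c d + pull c' d;
  pull1 : forall C A (d : ext C A), pull (idm C) d = d;
  pull_comp : forall C C' C'' A (c : hom C' C) (c' : hom C'' C')
    (d : ext C A), pull (c \oc c') d = pull c' (pull c d);
  push_pull : forall C C' A A' (a : hom A A') (c : hom C' C) (d : ext C A),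
    push a (pull c d) = pull c (push a d)
}.

Section Extriangulated.
Variables (B : precat) (E : bifunctor B).

(* [s C A d M x y] says that A -x-> M -y-> C belongs to the class s(d). *)
Definition realization_rel :=
  forall C A : B, E C A -> forall M : B, hom A M -> hom M C -> Prop.

Definition ext_sum (A A' AA' C C' CC' : B)
    (S : biproduct A A' AA') (T : biproduct C C' CC')
    (d : E C A) (d' : E C' A') : E CC' AA' :=
  push (in1 S) (pull (pr1 T) d) + push (in2 S) (pull (pr2 T) d').

Variable s : realization_rel.
Arguments s {_ _} _ {_} _ _.

Definition assigns_classes : Prop :=
  forall (C A : B) (d : E C A), exists (M : B) (x : hom A M) (y : hom M C),
    forall (M' : B) (x' : hom A M') (y' : hom M' C),
      s d x' y' <-> seq_equiv x y x' y'.

Definition ET2_morphism : Prop :=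
  forall (A M C A' M' C' : B) (d : E C A) (d' : E C' A')
    (x : hom A M) (y : hom M C) (x' : hom A' M') (y' : hom M' C')
    (a : hom A A') (c : hom C C'),
    s d x y -> s d' x' y' -> push a d = pull c d' ->
    exists b : hom M M', b \oc x = x' \oc a /\ y' \oc b = c \oc y.

Definition ET2_split : Prop :=
  forall (A C S : B) (b : biproduct A C S),
    s (0 : E C A) (in1 b) (pr2 b).

Definition ET2_sum : Prop :=
  forall (A A' AA' M M' MM' C C' CC' : B) (bA : biproduct A A' AA')
    (bM : biproduct M M' MM') (bC : biproduct C C' CC')
    (d : E C A) (d' : E C' A')
    (x : hom A M) (y : hom M C) (x' : hom A' M') (y' : hom M' C'),
    s d x y -> s d' x' y' ->
    s (ext_sum bA bC d d') (mor_sum bA bM x x') (mor_sum bM bC y y').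

Definition ET3 : Prop :=
  forall (A M C A' M' C' : B) (d : E C A) (d' : E C' A')
    (x : hom A M) (y : hom M C) (x' : hom A' M') (y' : hom M' C')
    (a : hom A A') (b : hom M M'),
    s d x y -> s d' x' y' -> b \oc x = x' \oc a ->
    exists c : hom C C', c \oc y = y' \oc b /\ push a d = pull c d'.

Definition ET3op : Prop :=
  forall (A M C A' M' C' : B) (d : E C A) (d' : E C' A')
    (x : hom A M) (y : hom M C) (x' : hom A' M') (y' : hom M' C')
    (b : hom M M') (c : hom C C'),
    s d x y -> s d' x' y' -> c \oc y = y' \oc b ->
    exists a : hom A A', b \oc x = x' \oc a /\ push a d = pull c d'.

Definition ET4 : Prop :=
  forall (A M C D F : B) (d : E D A) (d' : E F M)
    (f : hom A M) (f' : hom M D) (g : hom M C) (g' : hom C F),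
    s d f f' -> s d' g g' ->
    exists (G : B) (k : hom D G) (l : hom G F) (h' : hom C G) (d'' : E G A),
      [/\ h' \oc g = k \oc f' /\ l \oc h' = g',
          s d'' (g \oc f) h',
          s (push f' d') k l,
          pull k d'' = d
        & push f d'' = pull l d'].

Definition ET4op : Prop :=
  forall (A M C D F : B) (d : E A D) (d' : E M F)
    (f : hom M A) (f' : hom D M) (g : hom C M) (g' : hom F C),
    s d f' f -> s d' g' g ->
    exists (G : B) (k : hom G D) (l : hom F G) (h' : hom G C) (d'' : E A G),
      [/\ g \oc h' = f' \oc k /\ h' \oc l = g',
          s d'' h' (f \oc g),
          s (pull f' d') l k,
          push k d'' = d
        & pull f d'' = push l d'].

End Extriangulated.

Record extricat := Extricat {
  extricat_addcat :> addcat;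
  Ext : bifunctor extricat_addcat;
  realizes : realization_rel Ext;
  realizes_class : assigns_classes realizes;
  realizes_morphism : ET2_morphism realizes;
  realizes_split : ET2_split realizes;
  realizes_sum : ET2_sum realizes;
  realizes_ET3 : ET3 realizes;
  realizes_ET3op : ET3op realizes;
  realizes_ET4 : ET4 realizes;
  realizes_ET4op : ET4op realizes
}.

Arguments realizes {_ _ _} _ {_} _ _.

Section Cotorsion.
Variable B : extricat.
Implicit Types X Y U V : B -> Prop.

Definition conflation (A M C : B) (x : hom A M) (y : hom M C) : Prop :=
  exists d : Ext B C A, realizes d x y.

Definition deflation (M C : B) (y : hom M C) : Prop :=
  exists (A : B) (x : hom A M), conflation x y.

Definition projective (P : B) : Prop := forall (A : B) (d : Ext B P A), d = 0.

Definition enough_projectives : Prop :=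
  forall C : B, exists (P : B) (y : hom P C), projective P /\ deflation y.

Definition cone X Y (C : B) : Prop :=
  exists (A M : B) (x : hom A M) (y : hom M C), [/\ X A, Y M & conflation x y].

Definition cocone X Y (A : B) : Prop :=
  exists (M C : B) (x : hom A M) (y : hom M C), [/\ X M, Y C & conflation x y].

Definition extension X Y (M : B) : Prop :=
  exists (A C : B) (x : hom A M) (y : hom M C), [/\ X A, Y C & conflation x y].

Definition left_perp X (A : B) : Prop :=
  forall (M : B) (d : Ext B A M), X M -> d = 0.

Record cotorsion_pair U V : Prop := CotorsionPair {
  cot_addl : additive_sub U;
  cot_addr : additive_sub V;
  cot_isol : iso_closed U;
  cot_isor : iso_closed V;
  cot_summandl : summand_closed U;
  cot_summandr : summand_closed V;
  cot_ext : forall (A C : B) (d : Ext B A C), U A -> V C -> d = 0;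
  cot_cone : forall A : B, cone V U A;
  cot_cocone : forall A : B, cocone V U A
}.

Definition core U V (A : B) : Prop := U A /\ V A.

Definition heart_obj U V (A : B) : Prop :=
  cone V (core U V) A /\ cocone (core U V) U A.

Definition kernel U V : B -> Prop := add_closure (extension U V).

Definition coheart U V : B -> Prop := left_perp (kernel U V).

Lemma core_additive U V : cotorsion_pair U V -> additive_sub (core U V).
Proof.
case=> -[U0 US] [V0 VS] *; split=> [Z Z0|A C S b [UA VA] [UC VC]].
  by split; [apply: U0 | apply: V0].
by split; [apply: US b UA UC | apply: VS b VA VC].
Qed.

Lemma projective_additive : additive_sub projective.
Proof.
have pull0 A C C' (d : Ext B C A) : pull (0 : hom C' C) d = 0.
  by apply: (addrI (pull 0 d)); rewrite -pull_add !addr0.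
split=> [Z Z0 A d|A C S b PA PC M d].
  by rewrite -[d]pull1 (proj1 (Z0 Z) (idm Z)) pull0.
rewrite -[d]pull1 -(biprod_id b) pull_add !pull_comp.
rewrite (PA _ (pull (in1 b) d)) (PC _ (pull (in2 b) d)).
have pullr0 D D' N (c : hom D' D) : pull c (0 : Ext B D N) = 0.
  by apply: (addrI (pull c 0)); rewrite -pullD !addr0.
by rewrite !pullr0 addr0.
Qed.

(* H/W and C/P, as full subcategories of B/W and B/P; since W is contained in
   H and P in C, factoring in B through W (resp. P) is the same as factoring
   inside the subcategory. *)
Definition heart U V (cUV : cotorsion_pair U V) : precat :=
  @fullsub (idealquot (core_additive cUV)) (heart_obj U V).

Definition coheart_mod_proj U V : precat :=
  @fullsub (idealquot projective_additive) (coheart U V).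

End Cotorsion.

(* Main.v *)
From mathcomp Require Import all_boot all_algebra boolp.
Require Import Defs.

(** The equivalence sends an object X of the heart to the functor E(-, X)
    restricted to the coheart. It is defined on the quotients because E(P, -) =
    0 for P projective, and E(C, W) = 0 for C in the coheart and W in the core,
    the core being contained in the kernel. Write B^+ for [cone V (core U V)]
    and B^- for [cocone (core U V) U].

    For every X choose, by the cotorsion pair formed by the coheart and the
    kernel, conflations X -> K -> C0 with class d and K1 -> C1 -> K with class
    e, where C0 and C1 are in the coheart and K and K1 in the kernel. Since
    E(C, K) and E(C, K1) vanish for C in the coheart, the connecting map of the
    first conflation makes E(-, X) a quotient of Hom(-, C0), and the second one
    identifies the relations with the image of Hom(-, C1): the functor E(-, X)
    is coherent, generated by d.

    The key point is that K lies in U as soon as X lies in B^-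
    ([kernel_envelope_left]). Faithfulness: a map f : X -> Y killing d factors
    through K, and maps from U to B^+ factor through the core. Fullness: by
    Yoneda a natural transformation E(-, X) -> E(-, Y) is given by an element n
    of E(C0, Y) whose pullback to C1 vanishes; its pullback to K is then the
    pushout of e along some K1 -> Y, and such a pushout vanishes because K is
    in U and K1 is in the kernel ([push_kernel_cone]). Hence n is the pushout
    of d along some map X -> Y.

    Density: given c : C1 -> C0 in the coheart, a conflation L -> P -> C0 with
    P projective identifies E(-, L) with the maps to C0 modulo projectives, and
    if Q realizes the pullback of its class along c, then E(-, Q) is the
    cokernel of the transformation induced by c. Here Q lies in B^-, and its
    reflection Z in B^+ ([heart_reflection]) is in the heart with E(-, Z) =
    E(-, Q) on the coheart. *)

Set Implicit Arguments.
Unset Strict Implicit.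
Unset Printing Implicit Defensive.

Import GRing.Theory.
Local Open Scope ring_scope.
Local Open Scope cat_scope.

#[local] Obligation Tactic := idtac.

(** * Equivalences and coherent functors *)

Lemma fully_faithful_dense_equivalent (C D : category) (F : functor C D) :
  (forall X Y (g : mor (F X) (F Y)), exists f, fmap F f = g) ->
  (forall X Y (f f' : mor X Y), fmap F f = fmap F f' -> f = f') ->
  (forall Y, exists X (i : mor (F X) Y), is_isomorphism i) ->
  equivalent C D.
Proof.
move=> full faith dense.
pose lift X Y g := projT1 (boolp.cid (full X Y g)).
have liftK X Y g : fmap F (lift X Y g) = g := projT2 (boolp.cid (full X Y g)).
have {}dense Y : {X : C & {i : mor (F X) Y & {j : mor Y (F X) |
    ccomp j i = Defs.cid (F X) /\ ccomp i j = Defs.cid Y}}}.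
  case: (boolp.cid (dense Y)) => X /boolp.cid[i /boolp.cid[j ij]].
  by exists X, i, j.
pose G0 Y := projT1 (dense Y).
pose i Y : mor (F (G0 Y)) Y := projT1 (projT2 (dense Y)).
pose j Y : mor Y (F (G0 Y)) := sval (projT2 (projT2 (dense Y))).
have ji Y : ccomp (j Y) (i Y) = Defs.cid _.
  by rewrite /i /j; case: (projT2 (projT2 (dense Y))) => ? [].
have ij Y : ccomp (i Y) (j Y) = Defs.cid _.
  by rewrite /i /j; case: (projT2 (projT2 (dense Y))) => ? [].
pose G1 Y Y' (g : mor Y Y') :=
  lift (G0 Y) (G0 Y') (ccomp (j Y') (ccomp g (i Y))).
have G11 Y : G1 Y Y (Defs.cid Y) = Defs.cid (G0 Y).
  by apply: faith; rewrite liftK fmap1 ccomp1m ji.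
have G1c Y Y' Y'' (h : mor Y' Y'') (g : mor Y Y') :
    G1 _ _ (ccomp h g) = ccomp (G1 _ _ h) (G1 _ _ g).
  apply: faith; rewrite fmap_comp !liftK -!ccompA.
  by rewrite (ccompA (i Y')) ij ccomp1m.
exists F, (@Functor D C G0 G1 G11 G1c); split.
  exists (fun X => lift (G0 (F X)) X (i (F X))); split=> [X|X Y f].
    exists (lift X (G0 (F X)) (j (F X))).
    by split; apply: faith; rewrite fmap_comp !liftK ?ji ?ij fmap1.
  by apply: faith; rewrite !fmap_comp /= !liftK ccompA ij ccomp1m.
exists i; split=> [Y|Y Y' g]; last first.
  by rewrite /= liftK ccompA ij ccomp1m.
by exists (j Y); split; [apply: ji | apply: ij].
Qed.

Section NaturalTransformations.
Variable A : precat.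

Lemma nattrans0 (F G : addfun A) (a : nattrans F G) (X : A) : a X 0 = 0.
Proof. by apply: (addrI (a X 0)); rewrite -ntmapD !addr0. Qed.

Lemma nattransB (F G : addfun A) (a : nattrans F G) (X : A) s t :
  a X (s - t) = a X s - a X t.
Proof. by apply/eqP; rewrite -subr_eq0 opprB addrA -ntmapD subrK subrr. Qed.

(** The factorization sends b s to b' s; choosing a preimage s of each element
    suffices, as two preimages differ by an element of the kernel of b. *)
Lemma nattrans_factor (R F G : addfun A)
    (b : nattrans R F) (b' : nattrans R G) :
  (forall X t, exists s, b X s = t) ->
  (forall X s, b X s = 0 -> b' X s = 0) ->
  exists c : nattrans F G, forall X s, c X (b X s) = b' X s.
Proof.
move=> surj ker.
pose sec X t := projT1 (boolp.cid (surj X t)).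
have secK X t : b X (sec X t) = t := projT2 (boolp.cid (surj X t)).
have eqb X s s' : b X s = b X s' -> b' X s = b' X s'.
  move=> e; apply/eqP; rewrite -subr_eq0 -nattransB; apply/eqP/ker.
  by rewrite nattransB e subrr.
have cD X : {morph (fun t => b' X (sec X t)) : s t / s + t}.
  by move=> s t /=; rewrite -ntmapD; apply: eqb; rewrite ntmapD !secK.
have cn X Y (f : hom X Y) s :
    b' X (sec X (afmap (a := F) f s)) = afmap f (b' Y (sec Y s)).
  by rewrite -ntnat; apply: eqb; rewrite ntnat !secK.
by exists (Nattrans cD cn) => X s /=; apply: eqb; rewrite secK.
Qed.

Lemma coherent_iso (R : addfun A) (F G : mod_cat A)
    (b : nattrans R (sval F)) (b' : nattrans R (sval G)) :
  (forall X t, exists s, b X s = t) -> (forall X t, exists s, b' X s = t) ->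
  (forall X s, b X s = 0 <-> b' X s = 0) ->
  exists c : mor F G, is_isomorphism c.
Proof.
move=> surj surj' ker.
have [c cE] := nattrans_factor surj (fun X s => proj1 (ker X s)).
have [c' c'E] := nattrans_factor surj' (fun X s => proj2 (ker X s)).
exists c, c'; split; apply: nattrans_eq => X t /=.
  by have [s <-] := surj X t; rewrite cE c'E.
by have [s <-] := surj' X t; rewrite c'E cE.
Qed.

End NaturalTransformations.

(** * Long exact sequences of a conflation *)

Section Exactness.
Variable B : extricat.

Lemma push0 (C A A' : B) (a : hom A A') : push a (0 : Ext B C A) = 0.
Proof. by apply: (addrI (push a 0)); rewrite -pushD !addr0. Qed.

Lemma pull0 (C C' A : B) (c : hom C' C) : pull c (0 : Ext B C A) = 0.
Proof. by apply: (addrI (pull c 0)); rewrite -pullD !addr0. Qed.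

Lemma push_sub (C A A' : B) (a a' : hom A A') (d : Ext B C A) :
  push (a - a') d = push a d - push a' d.
Proof. by apply/eqP; rewrite -subr_eq0 opprB addrA -push_add subrK subrr. Qed.

Lemma pull_sub (C C' A : B) (c c' : hom C' C) (d : Ext B C A) :
  pull (c - c') d = pull c d - pull c' d.
Proof. by apply/eqP; rewrite -subr_eq0 opprB addrA -pull_add subrK subrr. Qed.

Lemma realization_exists (C A : B) (d : Ext B C A) :
  exists (M : B) (x : hom A M) (y : hom M C), realizes d x y.
Proof.
have [M [x [y /(_ M x y) [_ e]]]] := realizes_class d.
exists M, x, y; apply: e; exists (idm M); rewrite comp1m compm1; split=> //.
by exists (idm M); rewrite comp1m.
Qed.

Lemma realization_unique (C A M M' : B) (d : Ext B C A)
    (x : hom A M) (y : hom M C) (x' : hom A M') (y' : hom M' C) :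
  realizes d x y -> realizes d x' y' -> isomorphic M M'.
Proof.
have [N [x0 [y0 e]]] := realizes_class d.
move=> /e[b [[c [cb bc]] _ _]] /e[b' [[c' [c'b' b'c']] _ _]].
exists (b' \oc c), (b \oc c'); split.
  by rewrite -compA (compA c') c'b' comp1m bc.
by rewrite -compA (compA c) cb comp1m b'c'.
Qed.

Definition biproduct_swap (A C S : B) (b : biproduct A C S) : biproduct C A S :=
  Biproduct (pr2in2 b) (pr1in1 b) (pr2in1 b) (pr1in2 b)
    (etrans (addrC _ _) (biprod_id b)).

Section Conflation.
Variables (A M C : B) (d : Ext B C A) (x : hom A M) (y : hom M C).
Hypothesis dxy : realizes d x y.

(** Compare the split sequence A -> A + M -> M with the given one through the
    map (x, 1) : A + M -> M. *)
Lemma pull_deflation : pull y d = 0.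
Proof.
have [S [b]] := has_biproducts A M.
have xb : (x \oc pr1 b + pr2 b) \oc in1 b = x \oc idm A.
  by rewrite compDl -compA pr1in1 pr2in1 addr0.
have [c [cE]] := realizes_ET3 (realizes_split b) dxy xb.
have -> : c = y \oc idm M.
  rewrite -(compm1 c) -(pr2in2 b) compA cE -compA; congr (_ \oc _).
  by rewrite compDl -compA pr1in2 pr2in2 compm0 add0r.
by rewrite compm1 push0.
Qed.

Lemma push_inflation : push x d = 0.
Proof.
have [S [b]] := has_biproducts M C.
have yb : idm C \oc y = pr2 b \oc (in1 b + in2 b \oc y).
  by rewrite compDr compA pr2in1 pr2in2 add0r.
have [a [aE]] := realizes_ET3op dxy (realizes_split b) yb.
have -> : a = idm M \oc x.
  rewrite -(comp1m a) -(pr1in1 b) -compA -aE compA; congr (_ \oc _).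
  by rewrite compDr compA pr1in1 pr1in2 comp0m addr0.
by rewrite comp1m pull0.
Qed.

(** The element pull c d = 0 is realized by a split sequence over T, and
    realizing the morphism (1, c) of classes gives a map from A + T to M whose
    restriction to T is the lift. *)
Lemma lift_along_deflation (T : B) (c : hom T C) :
  pull c d = 0 -> exists t : hom T M, c = y \oc t.
Proof.
move=> cd; have [S [b]] := has_biproducts A T.
have [|m [_ mE]] := realizes_morphism (a := idm A) (c := c)
  (realizes_split b) dxy; first by rewrite push0 cd.
by exists (m \oc in2 b); rewrite compA mE -compA pr2in2 compm1.
Qed.

Lemma extend_along_inflation (T : B) (a : hom A T) :
  push a d = 0 -> exists t : hom M T, a = t \oc x.
Proof.
move=> ad; have [S [b]] := has_biproducts T C.
have [|m [mE _]] := realizes_morphism (a := a) (c := idm C) dxy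
  (realizes_split b); first by rewrite pull0.
by exists (pr1 b \oc m); rewrite -compA mE compA pr1in1 comp1m.
Qed.

End Conflation.

Section ExactSequences.
Variables (A M C : B) (d : Ext B C A) (x : hom A M) (y : hom M C).
Hypothesis dxy : realizes d x y.

(** If push x e = 0, then x extends to a realization of e, giving a map from
    that realization to the given conflation which is the identity on A. *)
Lemma ext_connecting_pull (T : B) (e : Ext B T A) :
  push x e = 0 -> exists c : hom T C, e = pull c d.
Proof.
have [N [x' [y' exy]]] := realization_exists e.
move=> /(extend_along_inflation exy)[t xE].
have tx : t \oc x' = x \oc idm A by rewrite -xE compm1.
have [c [_ cE]] := realizes_ET3 exy dxy tx.
by exists c; rewrite -cE push1.
Qed.

Lemma ext_connecting_push (T : B) (e : Ext B C T) :
  pull y e = 0 -> exists a : hom A T, e = push a d.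
Proof.
have [N [x' [y' exy]]] := realization_exists e.
move=> /(lift_along_deflation exy)[t yE].
have ty : idm C \oc y = y' \oc t by rewrite comp1m.
have [a [_ aE]] := realizes_ET3op dxy exy ty.
by exists a; rewrite aE pull1.
Qed.

(** Exactness in the middle is the octahedral axiom: composing x with an
    inflation realizing e produces an element d'' of E(G, A) and a sequence
    C -> G -> T of class push y e, so d'' can be pulled back along a section
    of G -> T once push y e = 0. *)
Lemma ext_push_exact (T : B) (e : Ext B T M) :
  push y e = 0 -> exists e' : Ext B T A, e = push x e'.
Proof.
have [N [x' [y' exy]]] := realization_exists e => ye.
have [G [k [l [h [d'' [_ _ kl _ xd]]]]]] := realizes_ET4 dxy exy.
rewrite ye in kl; have [r rE] := lift_along_deflation kl (pull0 _ (idm T)).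
by exists (pull r d''); rewrite push_pull xd -pull_comp -rE pull1.
Qed.

Lemma ext_pull_exact (T : B) (e : Ext B M T) :
  pull x e = 0 -> exists e' : Ext B C T, e = pull y e'.
Proof.
have [N [x' [y' exy]]] := realization_exists e => xe.
have [G [k [l [h [d'' [_ _ lk _ yd]]]]]] := realizes_ET4op dxy exy.
rewrite xe in lk; have [r rE] := extend_along_inflation lk (push0 _ (idm T)).
by exists (push r d''); rewrite -push_pull yd -push_comp -rE push1.
Qed.

End ExactSequences.

End Exactness.

(** * Cotorsion pairs, kernel and coheart *)

Section CotorsionPair.
Variables (B : extricat) (U V : B -> Prop) (cUV : cotorsion_pair U V).

(** An approximation N -> M -> A with N in V and M in U splits, so A is a
    summand of M. *)
Lemma left_class_of_ext (A : B) :
  (forall N (d : Ext B A N), V N -> d = 0) -> U A.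
Proof.
move=> A0; have [N [M [x [y [VN UM [d dxy]]]]]] := cot_cone cUV A.
have [S [b]] := has_biproducts N A.
rewrite (A0 N d VN) in dxy.
have US : U S := cot_isol cUV (realization_unique dxy (realizes_split b)) UM.
by apply: cot_summandl cUV _ _ _ US; exists N; split; apply: biproduct_swap.
Qed.

Lemma left_class_extension (A M C : B) (d : Ext B C A)
    (x : hom A M) (y : hom M C) : realizes d x y -> U A -> U C -> U M.
Proof.
move=> dxy UA UC; apply: left_class_of_ext => N e VN.
have [e' ->] := ext_pull_exact dxy (cot_ext cUV (pull x e) UA VN).
by rewrite (cot_ext cUV e' UC VN) pull0.
Qed.

(** Maps from an object of B^- to V factor through the core.  Together with its
    converse [cocone_core_of_pull] this describes B^- by vanishing conditions,
    which pass to extensions by U. *)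
Lemma cocone_core_pull (X N N' : B) (f : hom X N) (e : Ext B N N') :
  cocone (core U V) U X -> V N -> V N' -> pull f e = 0.
Proof.
move=> [W [C [x [y [[UW _] UC [d dxy]]]]]] VN VN'.
have [t ->] := extend_along_inflation dxy (cot_ext cUV (push f d) UC VN).
by rewrite pull_comp (cot_ext cUV (pull t e) UW VN') pull0.
Qed.

Lemma cocone_core_of_pull (X : B) :
  (forall N N' (f : hom X N) (e : Ext B N N'), V N -> V N' -> pull f e = 0) ->
  cocone (core U V) U X.
Proof.
move=> X0; have [N [C [x [y [VN UC [d dxy]]]]]] := cot_cocone cUV X.
exists N, C, x, y; split=> //; last by exists d.
split=> //; apply: left_class_of_ext => N' e VN'.
have [e' ->] := ext_pull_exact dxy (X0 N N' x e VN VN').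
by rewrite (cot_ext cUV e' UC VN') pull0.
Qed.

Lemma cocone_core_extension (A M C : B) (d : Ext B C A)
    (x : hom A M) (y : hom M C) :
  realizes d x y -> cocone (core U V) U A -> U C -> cocone (core U V) U M.
Proof.
move=> dxy HA UC; apply: cocone_core_of_pull => N N' f e VN VN'.
have xf0 : pull x (pull f e) = 0.
  by rewrite -pull_comp; apply: cocone_core_pull.
have [e' ->] := ext_pull_exact dxy xf0.
by rewrite (cot_ext cUV e' UC VN') pull0.
Qed.

Lemma factors_core (A Y : B) (f : hom A Y) :
  U A -> cone V (core U V) Y -> factors (core U V) f.
Proof.
move=> UA [N [W [x [y [VN HW [d dxy]]]]]].
have [t ->] := lift_along_deflation dxy (cot_ext cUV (pull f d) UA VN).
by exists W, y, t.
Qed.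

(** An object of U is a summand of its sum with a zero object of V. *)
Lemma kernel_left (A : B) : U A -> kernel U V A.
Proof.
move=> UA; have [Z Z0] := has_zero B; have [S [b]] := has_biproducts A Z.
exists S; split; last by exists Z.
exists A, Z, (in1 b), (pr2 b); split=> //; last first.
  by exists 0; apply: realizes_split.
exact: addsub_zero (cot_addr cUV) _ Z0.
Qed.

Lemma kernel_right (A : B) : V A -> kernel U V A.
Proof.
move=> VA; have [Z Z0] := has_zero B; have [S [b]] := has_biproducts Z A.
exists S; split; last by exists Z; split; apply: biproduct_swap.
exists Z, A, (in1 b), (pr2 b); split=> //; last first.
  by exists 0; apply: realizes_split.
exact: addsub_zero (cot_addl cUV) _ Z0.
Qed.

Lemma coheart_left_class (C : B) : coheart U V C -> U C.
Proof.
by move=> HC; apply: left_class_of_ext => N d VN; apply/HC/kernel_right.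
Qed.

Lemma projective_coheart (P : B) : projective P -> coheart U V P.
Proof. by move=> HP M d _; apply: HP. Qed.

Lemma push_factors_core (C X Y : B) (f : hom X Y) (e : Ext B C X) :
  coheart U V C -> factors (core U V) f -> push f e = 0.
Proof.
move=> HC [W [g [h [[UW _] ->]]]]; rewrite push_comp.
by rewrite (HC W (push h e) (kernel_left UW)) push0.
Qed.

Lemma pull_factors_projective (C C' X : B) (c : hom C' C) (e : Ext B C X) :
  factors (@projective B) c -> pull c e = 0.
Proof.
move=> [P [g [h [HP ->]]]]; rewrite pull_comp.
by rewrite (HP X (pull g e)) pull0.
Qed.

(** For N' in V the group E(K, N') embeds into E(X, N') because E(C, N') = 0.
    As K is a summand of an extension of N in V by an object of U, all of
    E(K, N') is pulled back from E(N, N') along a map K -> N, and the composite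
    X -> K -> N annihilates E(N, N') as X lies in B^-. *)
Lemma kernel_envelope_left (X K C : B) (d : Ext B C X)
    (x : hom X K) (y : hom K C) :
  realizes d x y -> cocone (core U V) U X -> kernel U V K -> U C -> U K.
Proof.
move=> dxy HX [S [[A [N [u [v [UA VN [e euv]]]]]] [K' [b]]]] UC.
apply: left_class_of_ext => N' t VN'.
have [t' tE] : exists t' : Ext B N N', pull (pr1 b) t = pull v t'.
  exact: (ext_pull_exact euv (cot_ext cUV _ UA VN')).
have {}tE : t = pull (v \oc in1 b) t'.
  by rewrite pull_comp -tE -pull_comp pr1in1 pull1.
have xt : pull x t = 0.
  by rewrite tE -pull_comp; apply: cocone_core_pull.
have [e' ->] := ext_pull_exact dxy xt.
by rewrite (cot_ext cUV e' UC VN') pull0.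
Qed.

(** K being a summand of an extension of an object of V by D in U, the element
    e comes from E(A, D); the induced map D -> Y factors through the core,
    whose objects are in V. *)
Lemma push_kernel_cone (A K Y : B) (g : hom K Y) (e : Ext B A K) :
  U A -> kernel U V K -> cone V (core U V) Y -> push g e = 0.
Proof.
move=> UA [S [[D [N [u [v [UD VN [d duv]]]]]] [K' [b]]]] HY.
have [e' eE] : exists e' : Ext B A D, push (in1 b) e = push u e'.
  exact: (ext_push_exact duv (cot_ext cUV _ UA VN)).
have -> : e = push (pr1 b \oc u) e'.
  by rewrite push_comp -eE -push_comp pr1in1 push1.
rewrite -push_comp compA.
have [W [i [j [[_ VW] ->]]]] := factors_core (g \oc pr1 b \oc u) UD HY.
by rewrite push_comp (cot_ext cUV (push j e') UA VW) push0.
Qed.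

End CotorsionPair.

(** * The functor from the heart to coherent functors *)

Section HeartFunctor.
Variables (B : extricat) (U V : B -> Prop) (cUV : cotorsion_pair U V).
Let PA := @projective_additive B.
Let WA := core_additive cUV.
Let CP := coheart_mod_proj U V.

Lemma pull_qrepr (C C' X : B) (c : hom C' C) (e : Ext B C X) :
  pull (qrepr (qpi PA c)) e = pull c e.
Proof.
apply/eqP; rewrite -subr_eq0 -pull_sub; apply/eqP.
by apply: pull_factors_projective; apply/(qpi_eq PA); rewrite qreprK.
Qed.

Lemma push_qrepr (C X Y : B) (f : hom X Y) (e : Ext B C X) :
  coheart U V C -> push (qrepr (qpi WA f)) e = push f e.
Proof.
move=> HC; apply/eqP; rewrite -subr_eq0 -push_sub; apply/eqP.
by apply: (push_factors_core cUV) => //; apply/(qpi_eq WA); rewrite qreprK.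
Qed.

Program Definition ext_functor (X : B) : addfun CP :=
  @Addfun CP (fun C => Ext B (sval C) X) (fun C' C c e => pull (qrepr c) e)
    _ _ _ _.
Next Obligation. by move=> X C' C c e e' /=; rewrite pullD. Qed.
Next Obligation.
move=> X C' C c c' e /=.
by rewrite -{1}(qreprK c) -{1}(qreprK c') -qpiD pull_qrepr pull_add.
Qed.
Next Obligation. by move=> X C e /=; rewrite pull_qrepr pull1. Qed.
Next Obligation.
by move=> X C'' C' C c c' e /=; rewrite pull_qrepr pull_comp.
Qed.

Program Definition ext_trans (X Y : B) (f : hom X Y) :
    nattrans (ext_functor X) (ext_functor Y) :=
  @Nattrans CP (ext_functor X) (ext_functor Y) (fun C e => push f e) _ _.
Next Obligation. by move=> X Y f C e e' /=; rewrite pushD. Qed.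
Next Obligation. by move=> X Y f C' C c e /=; rewrite push_pull. Qed.

(** The transformation that corresponds to d under the Yoneda lemma. *)
Program Definition ext_yoneda (X : B) (C : CP) (d : Ext B (sval C) X) :
    nattrans (representable C) (ext_functor X) :=
  @Nattrans CP (representable C) (ext_functor X)
    (fun C' c => pull (qrepr c) d) _ _.
Next Obligation.
move=> X C d C' c c' /=.
by rewrite -{1}(qreprK c) -{1}(qreprK c') -qpiD pull_qrepr pull_add.
Qed.
Next Obligation.
by move=> X C d C'' C' c c' /=; rewrite pull_qrepr pull_comp.
Qed.

Program Definition representable_map (C C' : CP) (c : hom C C') :
    nattrans (representable C) (representable C') :=
  @Nattrans CP (representable C) (representable C') (fun T t => c \oc t) _ _.
Next Obligation. by move=> C C' c T t t'; apply: compDr. Qed.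
Next Obligation. by move=> C C' c T T' t t'; apply: compA. Qed.

(** * Coherence, faithfulness and fullness *)

Hypothesis cCK : cotorsion_pair (coheart U V) (kernel U V).

(** The presentation is the composite C1 -> K -> C0 for conflations
    X -> K -> C0 and K1 -> C1 -> K: on the coheart, elements of E(-, X) are
    pullbacks of the class of the first one, and maps to K lift to C1. *)
Lemma ext_functor_coherent (X : B) : coherent (ext_functor X).
Proof.
have [K [C0 [x [y [KK HC0 [d dxy]]]]]] := cot_cocone cCK X.
have [K1 [C1 [k [p [KK1 HC1 [e ekp]]]]]] := cot_cone cCK K.
pose D0 : CP := exist _ C0 HC0; pose D1 : CP := exist _ C1 HC1.
pose c : hom D1 D0 := qpi PA (y \oc p).
exists D1, D0, (representable_map c), (@ext_yoneda X D0 d).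
split=> -[C HC] t; last first.
  have [s ->] := ext_connecting_pull dxy (HC K (push x t) KK).
  by exists (qpi PA s : hom (exist _ C HC : CP) D0) => /=; rewrite pull_qrepr.
split=> [/= td|[r <-] /=]; last first.
  rewrite -(qreprK r) qcompE pull_qrepr !pull_comp.
  by rewrite (pull_deflation dxy) !pull0.
have [s sE] := lift_along_deflation dxy td.
have [r rE] := lift_along_deflation ekp (HC K1 (pull s e) KK1).
exists (qpi PA r : hom (exist _ C HC : CP) D1) => /=.
by rewrite qcompE -compA -rE -sE qreprK.
Qed.

Program Definition heart_functor :
    functor (category_of (heart cUV)) (mod_cat CP) :=
  @Functor (category_of (heart cUV)) (mod_cat CP)
    (fun X => exist _ (ext_functor (sval X)) (ext_functor_coherent (sval X)))
    (fun X Y f => ext_trans (qrepr f)) _ _.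
Next Obligation.
by move=> X; apply: nattrans_eq => -[C HC] e /=; rewrite push_qrepr // push1.
Qed.
Next Obligation.
move=> X Y Z g f; apply: nattrans_eq => -[C HC] e /=.
by rewrite push_qrepr // push_comp.
Qed.

(** Only the value on the class d of X -> K -> C matters: f - f' kills d, hence
    extends to K, and K is in U. *)
Lemma heart_functor_faithful (X Y : category_of (heart cUV)) (f f' : mor X Y) :
  fmap heart_functor f = fmap heart_functor f' -> f = f'.
Proof.
case: X Y f f' => [X [HX1 HX]] [Y [HY HY2]] f f' eff.
have [K [C [x [y [KK HC [d dxy]]]]]] := cot_cocone cCK X.
have UK : U K.
  exact: (kernel_envelope_left cUV dxy HX KK (coheart_left_class cUV HC)).
rewrite -(qreprK f) -(qreprK f'); apply/qpi_eq.
have fd : push (qrepr f - qrepr f') d = 0.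
  have := congr1 (fun a : nattrans (ext_functor X) (ext_functor Y) =>
    a (exist _ C HC) d) eff.
  by rewrite push_sub /= => ->; rewrite subrr.
have [t ->] := extend_along_inflation dxy fd.
have [W [g [h [HW ->]]]] := factors_core cUV t UK HY.
by exists W, g, (h \oc x); rewrite compA.
Qed.

(** The value n of a at the class d of X -> K -> C determines a.  If n is
    push f d for some f, then f induces a; the obstruction to finding f is
    pull y n in E(K, Y), which vanishes by [push_kernel_cone]. *)
Lemma heart_functor_full (X Y : category_of (heart cUV))
    (a : mor (heart_functor X) (heart_functor Y)) :
  exists f, fmap heart_functor f = a.
Proof.
case: X Y a => [X [HX1 HX]] [Y [HY HY2]] /= a.
have [K [C [x [y [KK HC [d dxy]]]]]] := cot_cocone cCK X.
have UK : U K.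
  exact: (kernel_envelope_left cUV dxy HX KK (coheart_left_class cUV HC)).
have [K1 [C1 [k [p [KK1 HC1 [e ekp]]]]]] := cot_cone cCK K.
have anat (C' : B) (HC' : coheart U V C') (c : hom C' C) :
    a (exist _ C' HC') (pull c d) = pull c (a (exist _ C HC) d).
  pose q : hom (exist _ C' HC' : CP) (exist _ C HC : CP) := qpi PA c.
  by have := ntnat a q d; rewrite /= /q !pull_qrepr.
set n : Ext B C Y := a (exist _ C HC) d in anat.
have pyn : pull p (pull y n) = 0.
  rewrite -pull_comp -(anat C1 HC1) pull_comp (pull_deflation dxy) pull0.
  exact (nattrans0 a (exist _ C1 HC1)).
have [g gE] := ext_connecting_push ekp pyn.
have yn : pull y n = 0 by rewrite gE (push_kernel_cone cUV).
have [f fE] := ext_connecting_push dxy yn.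
exists (qpi WA f); apply: nattrans_eq => -[C' HC'] t /=.
have [c ->] := ext_connecting_pull dxy (HC' K (push x t) KK).
by rewrite push_qrepr // push_pull -fE anat.
Qed.

(** Z is the cone of the composite N -> A -> W of a U-approximation of Q with a
    V-envelope of A.  The class of Q -> Z -> C is pushed out along A -> Q, and
    E(T, A) = 0 for T in the coheart; therefore E(T, Q) -> E(T, Z) is
    injective. *)
Lemma heart_reflection (Q : B) : cocone (core U V) U Q ->
  exists (Z C : B) (q : hom Q Z) (l : hom Z C) (e : Ext B C Q),
    [/\ heart_obj U V Z, U C, realizes e q l &
      forall (T : B) (t : hom T C), coheart U V T -> pull t e = 0].
Proof.
move=> HQ.
have [N [A [v [u [VN UA [d dvu]]]]]] := cot_cone cUV Q.
have [W [C [i [j [VW UC [d' dij]]]]]] := cot_cocone cUV A.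
have [Z [q [l [h [d'' [_ Nz qz _ _]]]]]] := realizes_ET4 dvu dij.
exists Z, C, q, l, (push u d'); split=> //.
  split; last exact: (cocone_core_extension cUV qz HQ UC).
  exists N, W, (i \oc v), h; split=> //; last by exists d''.
  by split=> //; apply: (left_class_extension cUV dij).
move=> T t HT; rewrite -push_pull.
by rewrite (HT A (pull t d') (kernel_left cUV UA)) push0.
Qed.

(** * Density *)

Hypothesis enoughP : enough_projectives B.

(** With d the class of L -> P -> C0 and Q realizing pull c d, the element of
    E(C0, Z) obtained from d along L -> Q -> Z defines a surjection from the
    functor represented by C0 onto E(-, Z) with the same kernel as the one
    onto F, namely the maps that factor through c modulo projectives. *)
Lemma heart_functor_dense (F : mod_cat CP) :
  exists (X : category_of (heart cUV)) (i : mor (heart_functor X) F),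
    is_isomorphism i.
Proof.
have [D1 [D0 [a [b [bker bsurj]]]]] := proj2_sig F.
pose C1 : B := sval D1; pose C0 : B := sval D0.
have HC1 : coheart U V C1 := proj2_sig D1.
have HC0 : coheart U V C0 := proj2_sig D0.
pose c : hom C1 C0 := qrepr (a D1 (idm D1)).
have aE (C : CP) (r : hom C D1) : a C r = (qpi PA c : hom D1 D0) \oc r.
  have rE : afmap (a := representable D1) r (idm D1) = r := comp1m r.
  by rewrite /c qreprK -{1}rE ntnat.
have [P [y [HP [L [x [d dxy]]]]]] := enoughP C0.
have UP := coheart_left_class cUV (projective_coheart HP).
have UC0 := coheart_left_class cUV HC0.
have UC1 := coheart_left_class cUV HC1.
have HL : cocone (core U V) U L.
  apply: (cocone_core_of_pull cUV) => N N' f e VN VN'.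
  have [t ->] := extend_along_inflation dxy (cot_ext cUV (push f d) UC0 VN).
  by rewrite pull_comp (HP _ (pull t e)) pull0.
have [Q [q [y' dqy]]] := realization_exists (pull c d).
have HQ := cocone_core_extension cUV dqy HL UC1.
have [Z [C [k [l [e [HZ UC ekl e0]]]]]] := heart_reflection HQ.
exists (exist _ Z HZ).
apply: (@coherent_iso _ _ (heart_functor (exist _ Z HZ)) F
  (@ext_yoneda Z D0 (push (k \oc q) d)) b) => //=.
  (* Surjectivity: an element t of E(T, Z) comes from Q, then from L, then from
     a map T -> C0, as C, C1 and P are all in U. *)
  move=> [T HT] t.
  have [t1 ->] := ext_push_exact ekl (HT C (push l t) (kernel_left cUV UC)).
  have [t2 ->] := ext_push_exact dqy (HT C1 (push y' t1) (kernel_left cUV UC1)).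
  have xt2 := HT P (push x t2) (kernel_left cUV UP).
  have [s ->] := ext_connecting_pull dxy xt2.
  exists (qpi PA s : hom (exist _ T HT : CP) D0).
  by rewrite pull_qrepr push_comp !push_pull.
move=> [T HT] s; rewrite bker; split=> [|[r <-]]; last first.
  rewrite aE -(qreprK r) /= qcompE pull_qrepr pull_comp push_comp -!push_pull.
  by rewrite (push_pull q) (push_inflation dqy) pull0 push0.
(* If s is killed in E(T, Z), it is already killed in E(T, Q), so it agrees
   with some c r up to a map that lifts to P. *)
rewrite push_comp -!push_pull => /(ext_connecting_pull ekl)[t].
rewrite e0 // => /(ext_connecting_pull dqy)[r rE].
have sr : pull (qrepr s - c \oc r) d = 0.
  by rewrite pull_sub pull_comp -rE subrr.
have [t' tE] := lift_along_deflation dxy sr.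
exists (qpi PA r : hom (exist _ T HT : CP) D1).
rewrite aE /= qcompE -[RHS]qreprK; apply/esym/qpi_eq.
by exists P, y, t'.
Qed.

End HeartFunctor.

Theorem proposition4p15 (B : extricat) (U V : B -> Prop)
    (hproj : enough_projectives B)
    (cUV : cotorsion_pair U V)
    (cCK : cotorsion_pair (coheart U V) (kernel U V)) :
  equivalent (category_of (heart cUV)) (mod_cat (coheart_mod_proj U V)).
Proof.
apply: (@fully_faithful_dense_equivalent _ _ (heart_functor cUV cCK)).
- exact: heart_functor_full.
- exact: heart_functor_faithful.
- exact: heart_functor_dense.
Qed.
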